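(* Let $k$ be a field and $k_s$ the separable closure of $k$ in an algebraic closure $\overline{k}$. Let $p(z)\in k[z]$ have degree $>0$, let $\{z_1,\ldots,z_m\}$ be the set of distinct zeros of $p$ in $\overline{k}$, so that $p(z)=a\prod_{j=1}^m(z-z_j)^{d_j}$ in $\overline{k}[z]$ with $a\in k\setminus\{0\}$ and $d_j\in\mathbb{N}$. If $\{z_1,\ldots,z_m\}\subset k_s$, then \[ D^*(p):=\prod_{j=1}^m\prod_{i\neq j}(z_j-z_i)^{d_id_j}\in k\setminus\{0\}. \] *)

(* Defs.v *)
From HB Require Import structures.
From mathcomp Require Import all_boot all_order all_algebra all_field.

Set Implicit Arguments.
Unset Strict Implicit.
Unset Printing Implicit Defensive.

Import GRing.Theory.
Local Open Scope ring_scope.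

(* [closedFieldType] makes [K] algebraically closed; an algebraic closure of
   [k] is moreover algebraic over (the image under [iota] of) [k]. *)
Definition is_algebraic_closure (k : fieldType) (K : closedFieldType)
    (iota : {rmorphism k -> K}) : Prop :=
  forall x : K, algebraicOver iota x.

(* [x] has a separable minimal polynomial over [k]: up to a nonzero scalar, an
   irreducible [q] vanishing at [x] is that minimal polynomial.  [minPoly] and
   [separable_element] do not apply here, since they need [K] to have finite
   degree over [k]. *)
Definition separable_closure (k : fieldType) (K : closedFieldType)
    (iota : {rmorphism k -> K}) (x : K) : Prop :=
  exists q : {poly k},
    [/\ irreducible_poly q, root (map_poly iota q) x & separable_poly q].

Definition Dstar (K : fieldType) (m : nat) (z : 'I_m -> K) (d : 'I_m -> nat) : K :=
  \prod_(j < m) \prod_(i < m | i != j) (z j - z i) ^+ (d i * d j).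

(* Main.v *)
(* For each multiplicity e, the zeros z_j with d_j = e form a set stable under
   conjugation over k: the multiplicity of z_j is the least i such that the
   Hasse derivative p^`N(i) does not vanish at z_j.  By separability
   P_e = prod_(d_j = e) (X - z_j) then has coefficients in k.  Moreover
   prod_(i != j) (z_j - z_i)^(d_i) = p^`N(d_j)(z_j) / a, so D*(p) is the product
   over e of the e-th powers of prod_(d_j = e) p^`N(e)(z_j) / a; each of these
   is, up to a constant, a resultant of two polynomials over k. *)
Require Import Defs.
From HB Require Import structures.
From mathcomp Require Import all_boot all_order all_algebra all_field.

Set Implicit Arguments.
Unset Strict Implicit.
Unset Printing Implicit Defensive.

Import GRing.Theory.
Local Open Scope ring_scope.

(** The composite is the value at [x%:P + 'X] of [p] with its coefficients made constant
    polynomials, so Taylor's formula over the polynomial ring expands it in powers of ['X]. *)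
Lemma coef_comp_polyXaddC (R : comNzRingType) (p : {poly R}) (x : R) (i : nat) :
  (p \Po ('X + x%:P))`_i = p^`N(i).[x].
Proof.
have -> : p \Po ('X + x%:P) = \sum_(j < size p) p^`N(j).[x] *: 'X^j.
  have := nderiv_taylor (map_poly polyC p) (mulrC x%:P 'X).
  rewrite addrC size_map_polyC => E; rewrite [LHS]E; apply: eq_bigr => j _.
  by rewrite nderivn_map horner_map mul_polyC.
rewrite coef_sumMXn.
case: (ltnP i (size p)) => hi.
  by rewrite (big_pred1 (Ordinal hi)).
rewrite big1 => [|j /eqP ji]; last by move: (ltn_ord j); rewrite ji ltnNge hi.
by rewrite nderivn_poly0 // horner0.
Qed.

(** Translation by [x] turns the product into ['X^d] times the translate of [g], whose constant term
    is [g.[x]]. *)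
Lemma nderivn_XsubC_exp_mul (R : comNzRingType) (g : {poly R}) (x : R) (d i : nat) :
  (i <= d)%N ->
  (('X - x%:P) ^+ d * g)^`N(i).[x] = if i == d then g.[x] else 0.
Proof.
move=> le_id; rewrite -coef_comp_polyXaddC rmorphM rmorphXn /=.
rewrite comp_polyB comp_polyX comp_polyC addrK coefXnM ltn_neqAle le_id andbT.
case: eqP => //= ->; rewrite subnn -horner_coef0 horner_comp.
by rewrite hornerD hornerX hornerC add0r.
Qed.

Lemma prodr_const_seq (R : pzSemiRingType) (I : Type) (s : seq I) (x : R) :
  \prod_(i <- s) x = x ^+ size s.
Proof. by rewrite big_const_seq count_predT iter_mulr_1. Qed.

Section BaseField.

Variables (k : fieldType) (kbar : closedFieldType) (iota : {rmorphism k -> kbar}).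

Lemma root_map_split (r : {poly k}) :
  {s : seq kbar | map_poly iota r =
     iota (lead_coef r) *: \prod_(x <- s) ('X - x%:P)}.
Proof.
have [s E] := closed_field_poly_normal (map_poly iota r).
by exists s; rewrite {1}E lead_coef_map.
Qed.

(* Euclid's algorithm: reduce [r] modulo [q], then exchange the two polynomials. *)
Lemma prod_horner_roots_in (q r : {poly k}) (s : seq kbar) : q != 0 ->
  map_poly iota q = iota (lead_coef q) *: \prod_(x <- s) ('X - x%:P) ->
  exists c : k, \prod_(x <- s) (map_poly iota r).[x] = iota c.
Proof.
have [n] := ubnP (size q); elim: n q r s => // n IH q r s lt_q q0 E.
have lc0 : lead_coef q != 0 by rewrite lead_coef_eq0.
have modE : \prod_(x <- s) (map_poly iota r).[x] =
            \prod_(x <- s) (map_poly iota (r %% q)).[x].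
  rewrite !big_seq; apply: eq_bigr => x xs.
  rewrite map_modp horner_mod //.
  by rewrite E rootZ ?fmorph_eq0 // root_prod_XsubC.
rewrite {}modE; have := ltn_modpN0 r q0; set r1 := r %% q => lt_r1.
have [->|r10] := eqVneq r1 0.
  (* Every factor is 0, but the product is 1 when [s] is empty; the power covers both cases. *)
  exists (0 ^+ size s); rewrite rmorphXn /= !rmorph0.
  by under eq_bigr do rewrite horner0; rewrite prodr_const_seq.
have [t Et] := root_map_split r1.
have [c Ec] := IH r1 q t (leq_trans lt_r1 (ltnSE lt_q)) r10 Et.
(* Write each [r1(x)] as its leading coefficient times the product of [x - y] over [y] in [t]. For
   fixed [y], the product of [x - y] over [x] in [s] is [(-1) ^+ size s * q(y) / lead_coef q]. *)
exists (lead_coef r1 ^+ size s * (((-1) ^+ size s / lead_coef q) ^+ size t * c)).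
rewrite !rmorphM !rmorphXn rmorphM fmorphV rmorphXn rmorphN1 -Ec.
rewrite -!prodr_const_seq -!big_split /=.
under eq_bigr => x _ do rewrite Et hornerZ horner_prod.
rewrite big_split exchange_big; congr (_ * _); apply: eq_bigr => y _ /=.
rewrite E hornerZ horner_prod mulrA divfK ?fmorph_eq0 //.
rewrite -big_split; apply: eq_bigr => x _ /=.
by rewrite !hornerXsubC mulN1r opprB.
Qed.

(** Either [q] divides [r], or the two are coprime and cannot share the root [x]. *)
Lemma root_irreducible_conj (q r : {poly k}) (x y : kbar) :
  irreducible_poly q -> root (map_poly iota q) x -> root (map_poly iota q) y ->
  root (map_poly iota r) x -> root (map_poly iota r) y.
Proof.
move=> irr_q qx qy rx; have [qr|nqr] := boolP (q %| r).
  rewrite -(dvdp_map iota) in qr.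
  by move: qy; rewrite -!dvdp_XsubCl => /dvdp_trans; apply.
have := irreducible_poly_coprime r irr_q; rewrite nqr -(coprimep_map iota).
by move=> /coprimep_root /(_ qx); rewrite (rootP rx) eqxx.
Qed.

(* The hypothesis says that [s] is a union of Galois orbits of separable
   elements; the product is then split off one minimal polynomial at a time. *)
Lemma prod_XsubC_in (s : seq kbar) : uniq s ->
  (forall x, x \in s -> exists q : {poly k},
     [/\ irreducible_poly q, root (map_poly iota q) x, separable_poly q &
         forall y, root (map_poly iota q) y -> y \in s]) ->
  exists P : {poly k}, map_poly iota P = \prod_(x <- s) ('X - x%:P).
Proof.
have [n] := ubnP (size s); elim: n s => // n IH [|x s'] lt_s us stable.
  by exists 1; rewrite big_nil rmorph1.
set s := x :: s' in lt_s us stable *.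
have [q [irr_q qx sep_q q_s]] := stable x (mem_head x s').
have lq0 : lead_coef q != 0 by rewrite lead_coef_eq0 irredp_neq0.
have [t Et] := root_map_split q.
have mem_t y : (y \in t) = root (map_poly iota q) y.
  by rewrite Et rootZ ?fmorph_eq0 // root_prod_XsubC.
have ut : uniq t.
  have c0 : iota (lead_coef q) != 0 by rewrite fmorph_eq0.
  rewrite -separable_prod_XsubC -(eqp_separable (eqp_scale _ c0)) -Et.
  by rewrite separable_map.
pose s2 := [seq y <- s | y \notin t].
have [||y|P EP] := IH s2.
- apply: leq_trans (ltnSE lt_s); rewrite size_filter -(count_predC (mem t) s).
  rewrite -[X in (X < _)%N]add0n ltn_add2r -has_count.
  by apply/hasP; exists x; rewrite ?mem_head //= mem_t.
- exact: filter_uniq.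
- rewrite mem_filter => /andP[yt ys].
  have [r [irr_r ry sep_r r_s]] := stable y ys.
  (* A root [y'] of [r] lying in [t] would be a root of [q]; then [y] would be one too, contrary to
     the choice of [y] outside [t]. *)
  exists r; split => // y' ry'; rewrite mem_filter r_s // andbT mem_t.
  apply: contra yt => qy'; rewrite mem_t.
  exact: root_irreducible_conj irr_r ry' ry qy'.
exists ((lead_coef q)^-1 *: q * P).
rewrite rmorphM /= map_polyZ EP Et scalerA -rmorphM /= mulVf // rmorph1 scale1r.
rewrite big_filter [RHS](bigID (mem t)) /=; congr (_ * _).
rewrite -[RHS]big_filter; apply: perm_big; apply: uniq_perm => // [|y].
  exact: filter_uniq.
rewrite mem_filter; case: (boolP (y \in t)) => //=.
by rewrite mem_t => /q_s ->.
Qed.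

End BaseField.

Theorem theorem7 (k : fieldType) (kbar : closedFieldType)
    (iota : {rmorphism k -> kbar})
    (kbar_closure : is_algebraic_closure iota)
    (p : {poly k}) (deg_p : (0 < (size p).-1)%N)
    (m : nat) (z : 'I_m -> kbar) (z_distinct : injective z)
    (z_zeros : forall x : kbar,
       root (map_poly iota p) x <-> exists j : 'I_m, x = z j)
    (a : k) (a_neq0 : a != 0)
    (d : 'I_m -> nat) (d_gt0 : forall j : 'I_m, (0 < d j)%N)
    (p_factor : map_poly iota p =
       (iota a)%:P * \prod_(j < m) ('X - (z j)%:P) ^+ d j)
    (z_sep : forall j : 'I_m, separable_closure iota (z j)) :
  exists c : k, c != 0 /\ Dstar z d = iota c.
Proof.
(* [iota a * G j] is the value at [z j] of the cofactor of [('X - (z j)%:P) ^+ d j] in [p]. *)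
pose G j := \prod_(i < m | i != j) (z j - z i) ^+ d i.
have G_neq0 j : G j != 0.
  apply/prodf_neq0 => i ij; rewrite expf_neq0 // subr_eq0.
  by apply: contra ij => /eqP /z_distinct ->.
have hasse j i : (i <= d j)%N ->
    (map_poly iota p^`N(i)).[z j] = if i == d j then iota a * G j else 0.
  move=> le_id; rewrite -nderivn_map p_factor (bigD1 j) //= mulrCA.
  rewrite nderivn_XsubC_exp_mul //; case: eqP => // _.
  rewrite hornerM hornerC horner_prod; congr (_ * _).
  by apply: eq_bigr => l _; rewrite horner_exp hornerXsubC.
have hasse_lt j i : (i < d j)%N -> root (map_poly iota p^`N(i)) (z j).
  by move=> lt_id; apply/rootP; rewrite hasse ?(ltnW lt_id) // ltn_eqF.
have hasse_eq j : ~~ root (map_poly iota p^`N(d j)) (z j).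
  by rewrite /root hasse // eqxx mulf_neq0 ?fmorph_eq0.
have DstarE : Dstar z d = \prod_(j < m) G j ^+ d j.
  apply: eq_bigr => j _; rewrite -prodrXl.
  by apply: eq_bigr => i _; rewrite exprM.
have Dstar_neq0 : Dstar z d != 0.
  by rewrite DstarE; apply/prodf_neq0 => j _; rewrite expf_neq0.
suff [c Ec] : exists c, Dstar z d = iota c.
  by exists c; split=> //; rewrite -(fmorph_eq0 iota) -Ec.
(* A strict bound on the multiplicities: they then range over the finite type ['I_N], which allows
   one constant to be chosen for each. *)
pose N := (\max_(j < m) d j).+1.
have d_lt j : (d j < N)%N by rewrite ltnS leq_bigmax.
pose s (e : 'I_N) := [seq z j | j <- enum 'I_m & d j == e].
have conj_d j l q : irreducible_poly q ->
    root (map_poly iota q) (z j) -> root (map_poly iota q) (z l) -> (d l <= d j)%N.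
  (* If [d j < d l], the Hasse derivative of order [d j] vanishes at [z l], hence at its conjugate
     [z j], against [hasse_eq]. *)
  move=> irr_q qj ql; rewrite leqNgt; apply: contra (hasse_eq j) => /hasse_lt.
  exact: root_irreducible_conj irr_q ql qj.
have block e : exists c,
    \prod_(x <- s e) ((iota a)^-1 * (map_poly iota p^`N(e)).[x]) = iota c.
  have [||P EP] := @prod_XsubC_in k kbar iota (s e).
  - by rewrite map_inj_uniq // filter_uniq ?enum_uniq.
  - move=> x /mapP[j]; rewrite mem_filter => /andP[/eqP dj _] ->.
    have [q [irr_q qj sep_q]] := z_sep j; exists q; split=> // y qy.
    (* A conjugate of [z j] is again a zero [z l] of [p]; [conj_d] used in both directions gives
       [d l = d j]. *)
    have /z_zeros[l yl] : root (map_poly iota p) y.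
      by apply: root_irreducible_conj irr_q qj qy _; apply/z_zeros; exists j.
    rewrite {}yl in qy *; apply: map_f; rewrite mem_filter mem_enum andbT -dj.
    by rewrite eqn_leq !(conj_d _ _ q).
  have lcP : lead_coef P = 1.
    apply: (fmorph_inj iota).
    by rewrite -lead_coef_map EP rmorph1 lead_coef_prod_XsubC.
  have [||c Ec] := @prod_horner_roots_in _ _ iota P p^`N(e) (s e).
  - by rewrite -lead_coef_eq0 lcP oner_eq0.
  - by rewrite lcP rmorph1 scale1r.
  exists (a^-1 ^+ size (s e) * c).
  by rewrite big_split /= Ec prodr_const_seq rmorphM rmorphXn fmorphV.
have [c Ec] := fin_all_exists block.
exists (\prod_(e < N) c e ^+ e).
rewrite DstarE (partition_big (fun j => Ordinal (d_lt j)) predT) //= rmorph_prod.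
apply: eq_bigr => e _; rewrite rmorphXn /= -Ec -prodrXl.
rewrite big_map big_filter big_enum_cond.
apply: eq_big => [j|j /eqP <-] /=; first by rewrite -val_eqE.
by rewrite hasse // eqxx mulKf // fmorph_eq0.
Qed.
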